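(* For all $(q,r)\in\mathbb{B}\times\mathbb{B}$, $$\sum_{k=0}^\infty(k+1)(k+2)(k+3)\,Q_k(q)\,\overline r^{\,k}=2R^2(q,r)+4K_{\mathbb{B}}(q,r)R(q,r),$$ where $$R(q,r)=\left(1-2\mathrm{Re}(q)\overline r+|q|^2\overline r^2\right)^{-1},\qquad K_{\mathbb{B}}(q,r)=(1-2\overline q\,\overline r+\overline q^2\overline r^2)\,R(q,r)^2.$$
   Context: $\mathbb{B}=\{q\in\mathbb{H}:|q|<1\}$ is the open unit ball of the quaternions $\mathbb{H}$. $Q_k(q)=\sum_{j=0}^k\frac{2(k-j+1)}{(k+1)(k+2)}q^{k-j}\overline q^{\,j}$ for $k\ge0$. *)

(* Defs.v *)
From HB Require Import structures.
From mathcomp Require Import all_boot all_order all_algebra.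
From mathcomp Require Import ring lra.
From mathcomp Require Import all_classical all_reals all_analysis.

Set Implicit Arguments.
Unset Strict Implicit.
Unset Printing Implicit Defensive.

Import Order.TTheory GRing.Theory Num.Theory.
Import numFieldNormedType.Exports.

Local Open Scope ring_scope.

(** [Quat a b c d] is the quaternion a + b i + c j + d k over the reals [R]. *)
Record quat (R : Type) : Type := Quat { qre : R; qi : R; qj : R; qk : R }.

Definition quat_tuple (R : Type) (x : quat R) : R * R * R * R :=
  (qre x, qi x, qj x, qk x).
Definition tuple_quat (R : Type) (t : R * R * R * R) : quat R :=
  let: (a, b, c, d) := t in Quat a b c d.

Lemma quat_tupleK (R : Type) : cancel (@quat_tuple R) (@tuple_quat R).
Proof. by case. Qed.

HB.instance Definition _ (R : choiceType) :=
  Choice.copy (quat R) (can_type (@quat_tupleK R)).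

Section QuaternionAlgebra.
Context {R : realType}.
Implicit Types (x y z : quat R) (t : R).

Definition addq x y : quat R :=
  Quat (qre x + qre y) (qi x + qi y) (qj x + qj y) (qk x + qk y).

Definition oppq x : quat R := Quat (- qre x) (- qi x) (- qj x) (- qk x).

Fact addqA : associative addq.
Proof. by move=> x y z; rewrite /addq/= !addrA. Qed.

Fact addqC : commutative addq.
Proof. by move=> x y; congr Quat; rewrite addrC. Qed.

Fact add0q : left_id (Quat 0 0 0 0) addq.
Proof. by case=> *; rewrite /addq/= !add0r. Qed.

Fact addNq : left_inverse (Quat 0 0 0 0) oppq addq.
Proof. by move=> x; rewrite /addq/= !addNr. Qed.

HB.instance Definition _ :=
  GRing.isZmodule.Build (quat R) addqA addqC add0q addNq.

Definition mulq x y : quat R :=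
  Quat (qre x * qre y - qi x * qi y - qj x * qj y - qk x * qk y)
       (qre x * qi y + qi x * qre y + qj x * qk y - qk x * qj y)
       (qre x * qj y - qi x * qk y + qj x * qre y + qk x * qi y)
       (qre x * qk y + qi x * qj y - qj x * qi y + qk x * qre y).

Fact mulqA : associative mulq.
Proof. by move=> x y z; congr Quat => /=; ring. Qed.

Fact mul1q : left_id (Quat 1 0 0 0) mulq.
Proof. by case=> *; congr Quat => /=; ring. Qed.

Fact mulq1 : right_id (Quat 1 0 0 0) mulq.
Proof. by case=> *; congr Quat => /=; ring. Qed.

Fact mulqDl : left_distributive mulq +%R.
Proof. by move=> x y z; congr Quat => /=; ring. Qed.

Fact mulqDr : right_distributive mulq +%R.
Proof. by move=> x y z; congr Quat => /=; ring. Qed.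

Fact oneq_neq0 : Quat 1 0 0 0 != 0 :> quat R.
Proof. by apply/eqP => -[] /eqP; rewrite oner_eq0. Qed.

HB.instance Definition _ := GRing.Zmodule_isNzRing.Build (quat R)
  mulqA mul1q mulq1 mulqDl mulqDr oneq_neq0.

Definition scaleq t x : quat R :=
  Quat (t * qre x) (t * qi x) (t * qj x) (t * qk x).

Fact scaleqA a b x : scaleq a (scaleq b x) = scaleq (a * b) x.
Proof. by congr Quat => /=; ring. Qed.

Fact scale1q : left_id 1 scaleq.
Proof. by case=> *; congr Quat => /=; ring. Qed.

Fact scaleqDr : right_distributive scaleq +%R.
Proof. by move=> t x y; congr Quat => /=; ring. Qed.

Fact scaleqDl x : {morph scaleq^~ x : a b / a + b}.
Proof. by move=> a b; congr Quat => /=; ring. Qed.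

HB.instance Definition _ := GRing.Zmodule_isLmodule.Build R (quat R)
  scaleqA scale1q scaleqDr scaleqDl.

Fact scaleqAl t x y : t *: (x * y) = (t *: x) * y.
Proof. by congr Quat => /=; ring. Qed.

HB.instance Definition _ := GRing.Lmodule_isLalgebra.Build R (quat R) scaleqAl.

Fact scaleqAr t x y : t *: (x * y) = x * (t *: y).
Proof. by congr Quat => /=; ring. Qed.

HB.instance Definition _ := GRing.Lalgebra_isAlgebra.Build R (quat R) scaleqAr.

Definition conjq x : quat R := Quat (qre x) (- qi x) (- qj x) (- qk x).

Definition sqnormq x : R := qre x ^+ 2 + qi x ^+ 2 + qj x ^+ 2 + qk x ^+ 2.

Fact sqnormq_ge0 x : 0 <= sqnormq x.
Proof. by rewrite !addr_ge0 ?sqr_ge0. Qed.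

Fact sqnormq_eq0 x : (sqnormq x == 0) = (x == 0).
Proof.
apply/eqP/eqP => [|->]; last by rewrite /sqnormq /= expr0n !addr0.
case: x => a b c d /eqP; rewrite /sqnormq /= !paddr_eq0 ?addr_ge0 ?sqr_ge0//.
by rewrite !sqrf_eq0 => /andP[/andP[/andP[/eqP-> /eqP->] /eqP->] /eqP->].
Qed.

Definition invq x : quat R := (sqnormq x)^-1 *: conjq x.

Fact mulVq : {in [pred x | x != 0], left_inverse 1 invq *%R}.
Proof.
move=> x; rewrite inE -sqnormq_eq0 => x0; rewrite /invq -scaleqAl.
have -> : conjq x * x = sqnormq x *: 1.
  by congr Quat => /=; rewrite /sqnormq; ring.
by rewrite scalerA mulVf// scale1r.
Qed.

Fact mulqV : {in [pred x | x != 0], right_inverse 1 invq *%R}.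
Proof.
move=> x; rewrite inE -sqnormq_eq0 => x0; rewrite /invq -scaleqAr.
have -> : x * conjq x = sqnormq x *: 1.
  by congr Quat => /=; rewrite /sqnormq; ring.
by rewrite scalerA mulVf// scale1r.
Qed.

Fact unitqP x y : y * x = 1 /\ x * y = 1 -> x != 0.
Proof.
by case=> yx1 _; apply/eqP => x0; move: yx1; rewrite x0 mulr0 => /esym/eqP;
  rewrite oner_eq0.
Qed.

Fact invq_out : {in [predC [pred x | x != 0]], invq =1 id}.
Proof.
move=> x; rewrite inE/= negbK => /eqP ->.
by rewrite /invq; congr Quat => /=; rewrite ?oppr0 mulr0.
Qed.

HB.instance Definition _ := GRing.NzRing_hasMulInverse.Build (quat R)
  mulVq mulqV unitqP invq_out.

Definition normq x : R := Num.sqrt (sqnormq x).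

Fact ler_normqD x y : normq (x + y) <= normq x + normq y.
Proof.
rewrite -(@ler_pXn2r _ 2)// ?nnegrE ?addr_ge0 ?sqrtr_ge0//.
rewrite sqrrD !sqr_sqrtr ?sqnormq_ge0//.
pose dot := qre x * qre y + qi x * qi y + qj x * qj y + qk x * qk y.
suff dot_le : dot <= normq x * normq y.
  rewrite (_ : sqnormq (x + y) = sqnormq x + dot *+ 2 + sqnormq y).
    by rewrite lerD2r lerD2l lerMn2r.
  by rewrite /sqnormq /dot/=; ring.
rewrite -sqrtrM ?sqnormq_ge0// (le_trans (ler_norm _))// -sqrtr_sqr ler_wsqrtr//.
rewrite -subr_ge0.
rewrite (_ : _ - _ = sqnormq (Quat 0 (qre x * qi y - qi x * qre y)
    (qre x * qj y - qj x * qre y) (qre x * qk y - qk x * qre y)) +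
  sqnormq (Quat 0 (qi x * qj y - qj x * qi y)
    (qi x * qk y - qk x * qi y) (qj x * qk y - qk x * qj y))).
  by rewrite addr_ge0 ?sqnormq_ge0.
by rewrite /sqnormq /dot/=; ring.
Qed.

Fact normqZ t x : normq (t *: x) = `|t| * normq x.
Proof.
rewrite /normq -sqrtr_sqr -sqrtrM ?sqr_ge0//; congr Num.sqrt.
by rewrite /sqnormq/=; ring.
Qed.

Fact normq_eq0 x : normq x = 0 -> x = 0.
Proof.
move/eqP; rewrite sqrtr_eq0 => x_le0; apply/eqP.
by rewrite -sqnormq_eq0 eq_le x_le0 sqnormq_ge0.
Qed.

HB.instance Definition _ := Lmodule_isNormed.Build R (quat R)
  ler_normqD normqZ normq_eq0.

End QuaternionAlgebra.

Section Kernels.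
Context {R : realType}.
Implicit Types (q r : quat R).

Definition Qpoly (k : nat) q : quat R :=
  \sum_(j < k.+1)
    ((2 * (k - j + 1)%:R / ((k + 1)%:R * (k + 2)%:R)) : R)
      *: (q ^+ (k - j) * conjq q ^+ j).

Definition Rker q r : quat R :=
  (1 - (2 * qre q) *: conjq r + `|q| ^+ 2 *: conjq r ^+ 2)^-1.

Definition KBker q r : quat R :=
  (1 - 2 * (conjq q * conjq r) + conjq q ^+ 2 * conjq r ^+ 2) * Rker q r ^+ 2.

End Kernels.

(* Main.v *)
Require Import Defs.
From mathcomp Require Import all_boot all_order all_algebra.
From mathcomp Require Import all_classical all_reals all_analysis.
From mathcomp Require Import ring lra zify.
Import Order.TTheory GRing.Theory Num.Theory.
Import numFieldNormedType.Exports.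
Local Open Scope classical_set_scope.
Local Open Scope ring_scope.

Set Implicit Arguments.
Unset Strict Implicit.
Unset Printing Implicit Defensive.

(** Write [p] for the conjugate of [q] and [s] for the conjugate of [r].  The
    series has its coefficients, polynomials in [q] and [p], on the left of the
    powers of [s], and [q] commutes with [p].  The coefficients can therefore
    be computed as if [s] were a central variable [t].  In
    [(k + 1) (k + 2) (k + 3) Q_k] the monomial [q^a p^b] has coefficient
    [2 (a + 1) (a + b + 3)], so that with [x = q t], [y = p t] the generating
    function is
<<
  \sum_(a, b) 2 (a + 1) (a + b + 3) x^a y^b
    = 4 / ((1 - x)^3 (1 - y)) + 2 / ((1 - x)^2 (1 - y)^2).
>>
    The product [(1 - x) (1 - y) = 1 - 2 Re(q) t + |q|^2 t^2] has real
    coefficients, so multiplying by it is compatible with putting [s], which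
    does not commute with [q], in the place of [t]: it multiplies the value of
    the series on the right by the quaternion [A = 1 - 2 Re(q) s + |q|^2 s^2]
    ([quadratic_series_cvg0]).  On the double sequence of weights, it takes the
    difference in both indices ([monosum_mixed_diff]).

    Three such multiplications turn the weight [2 (a + 1) (a + b + 3)] into one
    with finite support ([Qpoly_weight_diff3]), and what remains is the
    polynomial [2 A + 4 (1 - 2 p s + p^2 s^2)].  Going back divides three times
    by [A] ([mono_series_div]), which gives [2 R^2 + 4 K R].

    The boundary terms vanish because weights of polynomial growth are beaten
    by the powers of [|s| < 1] ([monosum_expr_cvg0]).  That [A] is invertible
    comes from the same identity: for the constant weight [1] it says that the
    partial sums multiplied by [A] tend to [1] ([Rker_den_neq0]). *)

(** * Decay of polynomial times geometric sequences *)

(** Each of the [n + 1] terms of [1 + y + ... + y ^+ n] is at least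
    [y ^+ n]. *)
Lemma natr_expr_le {R : realFieldType} (y : R) (n : nat) : 0 <= y <= 1 ->
  n.+1%:R * (1 - y) * y ^+ n <= 1 - y ^+ n.+1.
Proof.
move=> /andP[y0 y1]; elim: n => [|n IHn]; first by rewrite expr0 expr1; lra.
have z0 : 0 <= y ^+ n.+1 by exact: exprn_ge0.
have z1 : y ^+ n.+1 <= 1 by exact: exprn_ile1.
have /(ler_wpM2l y0) : _ := IHn.
rewrite (exprS y n.+1) -(natr1 n.+1) => IH.
have -> : (n.+1%:R + 1) * (1 - y) * y ^+ n.+1 =
    y * (n.+1%:R * (1 - y) * y ^+ n) + (1 - y) * y ^+ n.+1.
  by rewrite exprS; ring.
by nra.
Qed.

(** One factor [n + 1] is absorbed at a time, at the price of replacing [x] by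
    its square root. *)
Lemma poly_geometric_bounded {R : rcfType} (m : nat) (x : R) : 0 <= x < 1 ->
  exists M, forall n, n.+1%:R ^+ m * x ^+ n <= M.
Proof.
elim: m x => [|m IHm] x /andP[x0 x1].
  by exists 1 => n; rewrite expr0 mul1r exprn_ile1 // ltW.
pose y := Num.sqrt x.
have y0 : 0 <= y by exact: sqrtr_ge0.
have y1 : y < 1 by rewrite -sqrtr1 ltr_sqrt.
have [M HM] : exists M, forall n, n.+1%:R ^+ m * y ^+ n <= M.
  by apply: IHm; rewrite y0.
exists ((1 - y)^-1 * M) => n.
have -> : n.+1%:R ^+ m.+1 * x ^+ n =
    (n.+1%:R * y ^+ n) * (n.+1%:R ^+ m * y ^+ n).
  by rewrite -(sqr_sqrtr x0) -/y -exprM mulnC exprM exprS; ring.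
apply: ler_pM => //; rewrite ?mulr_ge0 ?exprn_ge0 //.
rewrite -[leRHS]mulr1 ler_pdivlMl ?subr_gt0 //.
have := @natr_expr_le R y n; rewrite y0 (ltW y1) => /(_ isT).
have : 0 <= y ^+ n.+1 by exact: exprn_ge0.
by nra.
Qed.

Lemma cvg_poly_geometric {R : realType} (m : nat) (x : R) : 0 <= x < 1 ->
  (fun n => n.+1%:R ^+ m * x ^+ n) @ \oo --> (0 : R).
Proof.
move=> /andP[x0 x1]; pose y := Num.sqrt x.
have y0 : 0 <= y by exact: sqrtr_ge0.
have y1 : y < 1 by rewrite -sqrtr1 ltr_sqrt.
have [M HM] : exists M, forall n, n.+1%:R ^+ m * y ^+ n <= M.
  by apply: poly_geometric_bounded; rewrite y0.
apply: (@squeeze_cvgr _ _ _ _ (fun=> 0) (geometric M y)).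
- near=> n; rewrite /= mulr_ge0 ?exprn_ge0 //=.
  by rewrite -(sqr_sqrtr x0) -exprM mulnC exprM expr2 mulrA ler_wpM2r ?exprn_ge0.
- exact: cvg_cst.
- by apply: cvg_geometric; rewrite ger0_norm.
Unshelve. all: by end_near. Qed.

(** * Norm and topology of the quaternions *)

Section QuaternionNorm.
Context {R : realType}.
Implicit Types (x y q : quat R).

Lemma sqr_normq q : `|q| ^+ 2 = sqnormq q.
Proof. by rewrite sqr_sqrtr ?sqnormq_ge0. Qed.

Lemma normqM x y : `|x * y| = `|x| * `|y|.
Proof.
have -> : `|x * y| = Num.sqrt (sqnormq x * sqnormq y).
  by congr Num.sqrt; rewrite /sqnormq /=; ring.
by rewrite sqrtrM ?sqnormq_ge0.
Qed.

Lemma normqX x n : `|x ^+ n| = `|x| ^+ n.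
Proof.
elim: n => [|n IHn]; last by rewrite !exprS normqM IHn.
rewrite !expr0 -[RHS]sqrtr1; congr Num.sqrt.
by rewrite /sqnormq /= !expr0n !addr0 expr1n.
Qed.

Lemma normq_conj q : `|conjq q| = `|q|.
Proof. by congr Num.sqrt; rewrite /sqnormq /= !sqrrN. Qed.

Lemma conjqC q : GRing.comm (conjq q) q.
Proof. by congr Quat => /=; ring. Qed.

Lemma mulq_conj q : q * conjq q = (`|q| ^+ 2) *: 1.
Proof. by rewrite sqr_normq; congr Quat => /=; rewrite /sqnormq; ring. Qed.

Lemma addq_conj q : q + conjq q = (2 * qre q) *: 1.
Proof. by congr Quat => /=; ring. Qed.

(** Multiplication on the right is continuous because the norm is
    multiplicative. *)
Lemma cvgqMr (u : nat -> quat R) (l x : quat R) :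
  u @ \oo --> l -> (fun n => u n * x) @ \oo --> l * x.
Proof.
move=> /subr_cvg0/norm_cvg0P ul; apply/subr_cvg0/norm_cvg0P.
under eq_fun do rewrite -mulrBl normqM.
by rewrite -(mul0r `|x|); apply: cvgMr_tmp.
Qed.

End QuaternionNorm.

(** * Delaying a sequence *)

Definition delay {V : zmodType} (c : nat -> V) (k : nat) : V :=
  if k is k'.+1 then c k' else 0.

(** Along a series in powers of [s], with coefficients on the left, delaying
    the coefficients amounts to multiplying the sum by [s] on the right. *)
Section DelayedSeries.
Context {R : realType}.
Implicit Types (c : nat -> quat R) (s : quat R).

Lemma delay_expr_cvg0 c s : (fun k => c k * s ^+ k) @ \oo --> (0 : quat R) ->
  (fun k => delay c k * s ^+ k) @ \oo --> (0 : quat R).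
Proof.
move=> /(@cvgqMr _ _ _ s); rewrite mul0r => cs0; rewrite -cvg_shiftS.
by under eq_fun do rewrite /= exprSr mulrA.
Qed.

(** Delaying shifts the partial sums by one step, so the two series differ by
    a single term, [c n * s ^+ n * s], which tends to [0]. *)
Lemma delay_series_cvg0 c s :
  (fun k => c k * s ^+ k) @ \oo --> (0 : quat R) ->
  (fun n => series (fun k => delay c k * s ^+ k) n
              - series (fun k => c k * s ^+ k) n * s) @ \oo --> (0 : quat R).
Proof.
move=> /(@cvgqMr _ _ _ (- s)); rewrite mul0r -[X in _ -> X]cvg_shiftS.
apply: cvg_trans; apply: near_eq_cvg; apply: nearW => n /=.
have -> : series (fun k => delay c k * s ^+ k) n.+1 =
    series (fun k => c k * s ^+ k) n * s.
  rewrite /series /= big_nat_recl // mul0r add0r mulr_suml.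
  by apply: eq_bigr => i _; rewrite exprSr mulrA.
by rewrite seriesS mulrDl opprD addrCA subrr addr0 mulrN.
Qed.

(** Multiplying the generating function by [1 - a t + b t^2] multiplies the
    series by the value of this polynomial at [s]; [a] and [b] are real so that
    they can be moved from the left of the coefficients to the side of [s]. *)
Lemma quadratic_series_cvg0 c s (a b : R) :
  (fun k => c k * s ^+ k) @ \oo --> (0 : quat R) ->
  (fun n => series (fun k =>
       (c k - a *: delay c k + b *: delay (delay c) k) * s ^+ k) n
     - series (fun k => c k * s ^+ k) n * (1 - a *: s + b *: s ^+ 2)) @ \oo
    --> (0 : quat R).
Proof.
move=> cs0; have d0 := delay_series_cvg0 cs0.
have dd0 := delay_series_cvg0 (delay_expr_cvg0 cs0).
pose F c := series (fun k => c k * s ^+ k).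
have -> : (0 : quat R) = - (a *: 0) + b *: (0 + 0 * s).
  by rewrite mul0r addr0 !scaler0 oppr0 addr0.
have -> : (fun n => series (fun k =>
       (c k - a *: delay c k + b *: delay (delay c) k) * s ^+ k) n
     - series (fun k => c k * s ^+ k) n * (1 - a *: s + b *: s ^+ 2)) =
   (fun n => - (a *: (F (delay c) n - F c n * s)) +
     b *: ((F (delay (delay c)) n - F (delay c) n * s)
           + (F (delay c) n - F c n * s) * s)).
  apply/funext => n.
  have -> : series (fun k =>
      (c k - a *: delay c k + b *: delay (delay c) k) * s ^+ k) n =
    F c n - a *: F (delay c) n + b *: F (delay (delay c)) n.
    rewrite /F /series /= !scaler_sumr -sumrB -big_split /=.
    by apply: eq_bigr => k _; rewrite mulrDl mulrBl !scalerAl.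
  rewrite -/(F c) mulrDr mulrBr mulr1 -!scalerAr expr2 mulrA mulrBl subrKA.
  rewrite !scalerBr opprB opprD addrACA; congr (_ + _).
  by rewrite opprB addrC subrKA.
apply: cvgD.
  by apply: cvgN; apply: cvgZl_tmp.
by apply: cvgZl_tmp; apply: cvgD => //; apply: cvgqMr.
Qed.

End DelayedSeries.

(** * Sums of bihomogeneous monomials *)

Section Monomials.
Context {R : realType}.
Implicit Types (w : nat -> nat -> R) (q s : quat R).

(** The coefficient of [t ^+ k] in the series
    [\sum_(a, b) w a b *: (q t) ^+ a * (conjq q t) ^+ b], [t] central. *)
Definition monosum w q (k : nat) : quat R :=
  \sum_(j < k.+1) w (k - j)%N j *: (q ^+ (k - j) * conjq q ^+ j).

(** The effect on the weights of multiplying that series by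
    [(1 - q t) * (1 - conjq q t)]. *)
Definition mixed_diff w (a b : nat) : R :=
  (w a b - delay (w a) b) - delay (fun i => w i b - delay (w i) b) a.

Lemma monosum_comm w q k : GRing.comm (monosum w q k) (conjq q).
Proof.
apply/commr_sym/commr_sum => j _; apply/commr_sym.
rewrite /GRing.comm -scalerAl -scalerAr; congr (_ *: _).
apply/commr_sym/commrM; last exact/commrX.
exact/commrX/conjqC.
Qed.

(** Multiplication of the generating series by [1 - conjq q t]. *)
Lemma monosum_diffr w q k :
  monosum (fun a b => w a b - delay (w a) b) q k =
  monosum w q k - delay (monosum w q) k * conjq q.
Proof.
rewrite /monosum; under eq_bigr do rewrite scalerBl.
rewrite sumrB; congr (_ - _); rewrite big_ord_recl /= scale0r add0r.
case: k => [|k] /=; first by rewrite big_ord0 mul0r.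
rewrite mulr_suml; apply: eq_bigr => j _.
by rewrite /= subSS -scalerAl -mulrA -exprSr.
Qed.

(** Multiplication of the generating series by [1 - q t]. *)
Lemma monosum_diffl w q k :
  monosum (fun a b => w a b - delay (w^~ b) a) q k =
  monosum w q k - q * delay (monosum w q) k.
Proof.
rewrite /monosum; under eq_bigr do rewrite scalerBl.
rewrite sumrB; congr (_ - _); rewrite big_ord_recr /= subnn scale0r addr0.
case: k => [|k] /=; first by rewrite big_ord0 mulr0.
rewrite mulr_sumr; apply: eq_bigr => j _.
by rewrite /= subSn -1?ltnS //= -scalerAr mulrA -exprS.
Qed.

(** As [q + conjq q] and [q * conjq q] are real, the product
    [(1 - q t) * (1 - conjq q t)] has real coefficients. *)
Lemma monosum_mixed_diff w q k :
  monosum (mixed_diff w) q k =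
  monosum w q k - (2 * qre q) *: delay (monosum w q) k
    + `|q| ^+ 2 *: delay (delay (monosum w q)) k.
Proof.
rewrite [LHS](@monosum_diffl (fun a b => w a b - delay (w a) b)).
rewrite -(mul1r (delay (monosum w q) k)) -(mul1r (delay (delay _) k)).
rewrite !scalerAl -addq_conj -mulq_conj.
case: k => [|k]; rewrite /= !monosum_diffr /= ?mulr0 ?mul0r ?subr0 ?addr0 //.
have -> : delay (monosum w q) k * conjq q = conjq q * delay (monosum w q) k.
  by case: k => [|k] /=; rewrite ?mul0r ?mulr0 // monosum_comm.
rewrite mulrBr opprB mulrDl -monosum_comm mulrA opprD addrACA [RHS]addrAC.
by congr (_ + _); rewrite addrC.
Qed.

(** * Weights of polynomial growth *)

Definition polynomial_growth w : Prop :=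
  exists C m, forall a b, `|w a b| <= C * (a + b).+1%:R ^+ m.

Lemma mixed_diff_growth w : polynomial_growth w ->
  polynomial_growth (mixed_diff w).
Proof.
move=> [C [m Hw]].
have C0 : 0 <= C.
  by have := le_trans (normr_ge0 _) (Hw 0 0); rewrite expr1n mulr1.
exists (4 * C), m => a b.
have mono i j : (i <= a)%N -> (j <= b)%N ->
    `|w i j| <= C * (a + b).+1%:R ^+ m.
  move=> ia jb; apply: (le_trans (Hw i j)); rewrite ler_wpM2l //.
  by rewrite lerXn2r ?nnegrE ?ler0n // ler_nat ltnS leq_add.
have mono0 : `|0 : R| <= C * (a + b).+1%:R ^+ m.
  by rewrite normr0 mulr_ge0 // exprn_ge0.
have norm4 (x y z t B : R) : `|x| <= B -> `|y| <= B -> `|z| <= B ->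
    `|t| <= B -> `|x - y - (z - t)| <= 4 * B.
  rewrite !ler_norml => /andP[? ?] /andP[? ?] /andP[? ?] /andP[? ?].
  by apply/andP; split; lra.
rewrite -mulrA /mixed_diff; case: a b mono mono0 => [|a] [|b] mono mono0 /=.
- by rewrite -[X in _ - X](subr0 0); apply: norm4 => //; exact: mono.
- by rewrite -[X in _ - X](subr0 0); apply: norm4 => //; exact: mono.
- by apply: norm4 => //; exact: mono.
- by apply: norm4; exact: mono.
Qed.

(** Since [|q| <= 1], each of the [k + 1] monomials in the [k]-th coefficient
    has norm at most [1], so the coefficients grow polynomially. *)
Lemma monosum_expr_cvg0 w q s : polynomial_growth w ->
  `|q| < 1 -> `|s| < 1 ->
  (fun k => monosum w q k * s ^+ k) @ \oo --> (0 : quat R).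
Proof.
move=> [C [m Hw]] q1 s1; apply/norm_cvg0P.
have C0 : 0 <= C.
  by have := le_trans (normr_ge0 _) (Hw 0 0); rewrite expr1n mulr1.
apply: (@squeeze_cvgr _ _ _ _ (fun=> 0)
  (fun k => C * (k.+1%:R ^+ m.+1 * `|s| ^+ k))).
- near=> k; rewrite normr_ge0 /= normqM normqX mulrA ler_wpM2r ?exprn_ge0 //.
  apply: (le_trans (ler_norm_sum _ _ _)).
  have -> : C * k.+1%:R ^+ m.+1 = \sum_(j < k.+1) C * k.+1%:R ^+ m.
    by rewrite sumr_const card_ord exprSr mulrA mulr_natr.
  apply: ler_sum => j _; rewrite normrZ normqM !normqX normq_conj -exprD.
  have jk : (k - j + j = k)%N by rewrite subnK // -ltnS.
  rewrite jk -[leRHS]mulr1; apply: ler_pM; rewrite ?exprn_ge0 //.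
    by have := Hw (k - j)%N j; rewrite jk.
  by rewrite exprn_ile1 // ltW.
- exact: cvg_cst.
- rewrite -[X in _ --> X](mulr0 C); apply: cvgMl_tmp.
  by apply: cvg_poly_geometric; rewrite normr_ge0.
Unshelve. all: by end_near. Qed.

End Monomials.

(** * Dividing by the quadratic denominator of the kernels *)

Section KernelSeries.
Context {R : realType}.
Implicit Types (w : nat -> nat -> R) (q r : quat R).

Definition mono_series w q r : nat -> quat R :=
  series (fun k => monosum w q k * conjq r ^+ k).

Definition Rker_den q r : quat R :=
  1 - (2 * qre q) *: conjq r + `|q| ^+ 2 *: conjq r ^+ 2.

Lemma mono_series_mixed_diff w q r : polynomial_growth w ->
  `|q| < 1 -> `|r| < 1 ->
  (fun n => mono_series (mixed_diff w) q r n - mono_series w q r n * Rker_den q r)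
    @ \oo --> (0 : quat R).
Proof.
move=> gw q1 r1; have s1 : `|conjq r| < 1 by rewrite normq_conj.
have := quadratic_series_cvg0 (2 * qre q) (`|q| ^+ 2)
  (monosum_expr_cvg0 gw q1 s1).
by under eq_fun do under eq_fun do rewrite -monosum_mixed_diff.
Qed.

(** The geometric series [1 / ((1 - x) (1 - y))] times its denominator. *)
Lemma mixed_diff1 a b :
  mixed_diff (fun _ _ => 1 : R) a b = ((a == 0%N) && (b == 0%N))%:R.
Proof. by case: a b => [|a] [|b]; rewrite /mixed_diff /=; ring. Qed.

(** For the constant weight [1], the differenced series has all its non-empty
    partial sums equal to [1], while a vanishing denominator would force them
    to tend to [0]. *)
Lemma Rker_den_neq0 q r : `|q| < 1 -> `|r| < 1 -> Rker_den q r != 0.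
Proof.
move=> q1 r1; apply/eqP => den0.
have g1 : polynomial_growth (fun _ _ => 1 : R).
  by exists 1, 0%N => a b; rewrite expr0 mulr1 normr1.
have := mono_series_mixed_diff g1 q1 r1; rewrite den0.
under eq_fun do rewrite mulr0 subr0.
have mono1 k : monosum (mixed_diff (fun _ _ => 1 : R)) q k = (k == 0%N)%:R.
  case: k => [|k].
    by rewrite /monosum big_ord1 mixed_diff1 /= scale1r expr0 mulr1.
  rewrite /monosum big1 // => j _.
  by rewrite mixed_diff1 -addn_eq0 subnK /= ?scale0r // -ltnS.
rewrite -cvg_shiftS => series0.
have /(norm_cvg_unique series0) /eqP : (fun n =>
    mono_series (mixed_diff (fun _ _ => 1 : R)) q r n.+1) @ \oo
    --> (1 : quat R).
  apply: cvg_near_cst; apply: nearW => n.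
  rewrite /mono_series /series /= big_nat_recl //= mono1 expr0 mulr1.
  by rewrite big1 ?addr0 // => k _; rewrite mono1 mul0r.
by rewrite eq_sym oner_eq0.
Qed.

Lemma mono_series_div w q r (l : quat R) : polynomial_growth w ->
  `|q| < 1 -> `|r| < 1 ->
  mono_series (mixed_diff w) q r @ \oo --> l ->
  mono_series w q r @ \oo --> l * Rker q r.
Proof.
move=> gw q1 r1 wl.
have den_unit : Rker_den q r \is a GRing.unit by rewrite qualifE /=; exact: Rker_den_neq0.
have -> : mono_series w q r = fun n => mono_series w q r n * Rker_den q r * Rker q r.
  by apply/funext => n; rewrite mulrK.
apply: cvgqMr.
have : (fun n => mono_series (mixed_diff w) q r n -
    (mono_series (mixed_diff w) q r n - mono_series w q r n * Rker_den q r)) @ \oo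
    --> l - 0.
  by apply: cvgB => //; exact: mono_series_mixed_diff.
by rewrite subr0; under eq_fun do rewrite subKr.
Qed.

Definition Qpoly_weight (a b : nat) : R := 2 * a.+1%:R * (a + b + 3)%:R.

Lemma Qpoly_weight_growth : polynomial_growth Qpoly_weight.
Proof.
exists 6, 2 => a b.
rewrite /Qpoly_weight ger0_norm ?mulr_ge0 // -(natrM _ 2) -natrM -natrX -natrM.
by rewrite ler_nat; nia.
Qed.

Lemma series_Qpoly_weight q r :
  series (fun k : nat =>
      ((k + 1)%:R * (k + 2)%:R * (k + 3)%:R : R)
        *: (Qpoly k q * conjq r ^+ k)) = mono_series Qpoly_weight q r.
Proof.
congr series; apply/funext => k; rewrite scalerAl; congr (_ * _).
rewrite /Qpoly /monosum scaler_sumr; apply: eq_bigr => j _.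
rewrite scalerA; congr (_ *: _); rewrite /Qpoly_weight subnK; last first.
  by rewrite -ltnS.
by rewrite -addn1; field; rewrite natr1 -natrD !pnatr_eq0 addnS.
Qed.

(** These are the coefficients of
    [2 (1 - x) (1 - y) + 4 (1 - y)^2], the numerator left once the generating
    function of [Qpoly_weight] has been multiplied by
    [((1 - x) (1 - y))^3]. *)
Lemma Qpoly_weight_diff3 a b :
  mixed_diff (mixed_diff (mixed_diff Qpoly_weight)) a b =
  match a, b with
  | 0%N, 0%N => 6
  | 0%N, 1%N => - 10
  | 0%N, 2%N => 4
  | 1%N, 0%N => - 2
  | 1%N, 1%N => 2
  | _, _ => 0
  end.
Proof.
rewrite /mixed_diff /Qpoly_weight.
by case: a => [|[|[|[|a]]]]; case: b => [|[|[|[|b]]]] /=; ring.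
Qed.

Lemma mono_series_Qpoly_weight_diff3 q r :
  mono_series (mixed_diff (mixed_diff (mixed_diff Qpoly_weight))) q r @ \oo
    --> 2 * Rker_den q r
      + 4 * (1 - 2 * (conjq q * conjq r) + conjq q ^+ 2 * conjq r ^+ 2).
Proof.
(* The coefficients vanish from index 3 on. *)
rewrite -(cvg_shiftn 3); apply: cvg_near_cst; apply: nearW => n /=.
have ms0 : monosum (mixed_diff (mixed_diff (mixed_diff Qpoly_weight))) q 0
    = 6 *: 1.
  by rewrite /monosum big_ord1 Qpoly_weight_diff3 mulr1.
have ms1 : monosum (mixed_diff (mixed_diff (mixed_diff Qpoly_weight))) q 1
    = (- 2) *: q + (- 10) *: conjq q.
  rewrite /monosum !big_ord_recl big_ord0 !Qpoly_weight_diff3 /=.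
  by rewrite !expr0 !expr1 mulr1 mul1r addr0.
have ms2 : monosum (mixed_diff (mixed_diff (mixed_diff Qpoly_weight))) q 2
    = 2 *: (q * conjq q) + 4 *: conjq q ^+ 2.
  rewrite /monosum !big_ord_recl big_ord0 !Qpoly_weight_diff3 /=.
  by rewrite scale0r add0r !expr0 !expr1 mul1r addr0.
have ms3 k :
    monosum (mixed_diff (mixed_diff (mixed_diff Qpoly_weight))) q k.+3 = 0.
  rewrite /monosum big1 // => j _; rewrite Qpoly_weight_diff3.
  have : (k.+3 - j + j = k.+3)%N by rewrite subnK // -ltnS.
  case: (k.+3 - j)%N => [|[|a]]; case: (nat_of_ord j) => [|[|[|b]]] //=;
    by rewrite ?scale0r // !addSn.
rewrite /mono_series /series /= addn3 !big_nat_recl // big1; last first.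
  by move=> k _; rewrite ms3 mul0r.
have denE : Rker_den q r =
    1 - (q * conjq r + conjq q * conjq r) + q * conjq q * conjq r ^+ 2.
  by rewrite -mulrDl addq_conj mulq_conj -!scalerAl !mul1r.
rewrite addr0 ms0 ms1 ms2 expr0 mulr1 expr1 denE.
have natrM_scale m (x : quat R) : m%:R * x = (m%:R : R) *: x.
  by rewrite mulr_natl scaler_nat.
rewrite !(natrM_scale 2%N) (natrM_scale 4%N) !mulrDl -!scalerAl.
(* What is left is linear in the monomials, so that they can be replaced by
   arbitrary quaternions and compared coordinate by coordinate. *)
move: (1 : quat R) (q * conjq r) (conjq q * conjq r) => e x y.
move: (q * conjq q * conjq r ^+ 2) (conjq q ^+ 2 * conjq r ^+ 2) => z w.
case: e x y z w => [e0 e1 e2 e3] [x0 x1 x2 x3]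
  [y0 y1 y2 y3] [z0 z1 z2 z3] [w0 w1 w2 w3].
by congr Quat => /=; ring.
Qed.

End KernelSeries.

Theorem theorem6p4 (R : realType) (q r : quat R)
    (hq : `|q| < 1) (hr : `|r| < 1) :
  series (fun k : nat =>
      ((k + 1)%:R * (k + 2)%:R * (k + 3)%:R : R)
        *: (Qpoly k q * conjq r ^+ k)) @ \oo
    --> 2 * Rker q r ^+ 2 + 4 * (KBker q r * Rker q r).
Proof.
rewrite series_Qpoly_weight.
have den_unit : Rker_den q r \is a GRing.unit.
  by rewrite qualifE /=; exact: Rker_den_neq0.
have g0 := @Qpoly_weight_growth R.
have g1 := mixed_diff_growth g0; have g2 := mixed_diff_growth g1.
have -> : 2 * Rker q r ^+ 2 + 4 * (KBker q r * Rker q r) =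
    (2 * Rker_den q r
      + 4 * (1 - 2 * (conjq q * conjq r) + conjq q ^+ 2 * conjq r ^+ 2))
    * Rker q r * Rker q r * Rker q r.
  rewrite /KBker (_ : Rker q r = (Rker_den q r)^-1) //.
  set numer := (X in _ = (_ + 4 * X) * _ * _ * _).
  rewrite [in RHS](mulrDl (2 * _)) mulrK // (mulrDl 2) (mulrDl (2 / _)).
  by rewrite -/numer expr2 !mulrA.
apply: (mono_series_div g0 hq hr).
apply: (mono_series_div g1 hq hr).
apply: (mono_series_div g2 hq hr).
exact: mono_series_Qpoly_weight_diff3.
Qed.
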